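(* Let $\mathbb{H}_3$ be the $3$-dimensional Heisenberg group with Lie algebra $\mathfrak{h}_3$, let $\{X_1,X_2,X_3\}$ be the basis of $\mathfrak{h}_3$ with $[X_1,X_2]=X_3$, $[X_1,X_3]=[X_2,X_3]=0$, and let $\{\omega_1,\omega_2,\omega_3\}$ be its dual basis. Every $\mathbb{Z}_2^2$-symmetric Lorentzian metric $g$ on $\mathbb{H}_3$ such that the component of the grading of $\mathfrak{h}_3$ containing the center is degenerate is reduced, by an automorphism of $\mathfrak{h}_3$, to the form $$g=\omega_1^2+\omega_3^2-(\omega_2-\omega_3)^2.$$
   Context: $\mathbb{H}_3$ is the group of real upper triangular unipotent $3\times 3$ matrices; left-invariant metrics on $\mathbb{H}_3$ are identified with bilinear forms on $\mathfrak{h}_3$. A Lorentzian metric on an $n$-manifold is a smooth field of non-degenerate quadratic forms of signature $(n-1,1)$. A subgroup $\Gamma\subset \mathrm{Aut}(\mathfrak{h}_3)$ isomorphic to $\mathbb{Z}_2^2=(\mathbb{Z}/2\mathbb{Z})^2$ consists of commuting involutive automorphisms, and its simultaneous eigenspace decomposition is a $\mathbb{Z}_2^2$-grading $\mathfrak{h}_3=\bigoplus_{\gamma\in\mathbb{Z}_2^2}\mathfrak{g}_\gamma$ with $[\mathfrak{g}_\gamma,\mathfrak{g}_{\gamma'}]\subset\mathfrak{g}_{\gamma\gamma'}$, where $\mathfrak{g}_\epsilon$ ($\epsilon$ the unit of $\mathbb{Z}_2^2$) is the space of vectors fixed by $\Gamma$. A $\mathbb{Z}_2^2$-symmetric structure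 on $\mathbb{H}_3=\mathbb{H}_3/\{e\}$ is the structure given by such a grading (with $\mathfrak{g}_\epsilon=\{0\}$, so the isotropy subgroup $H$ is trivial). A $\mathbb{Z}_2^2$-symmetric Lorentzian metric for this structure is an $\mathbb{H}_3$-invariant (i.e. left-invariant) Lorentzian metric $g$, with associated bilinear form $B$ on $\mathfrak{h}_3$, such that one of the following holds: (1) the components $\mathfrak{g}_\gamma$, $\gamma\neq\epsilon$, are pairwise orthogonal and non-degenerate with respect to $B$; (2) one component $\mathfrak{g}_{\lambda_0}$, $\lambda_0\neq\epsilon$, is degenerate, the other components are orthogonal and non-degenerate, and there exists a component $\mathfrak{g}_{\lambda_1}$ such that the restriction of $B$ to $\mathfrak{g}_{\lambda_0}\oplus\mathfrak{g}_{\lambda_1}$ has signature $(1,1)$. The center of $\mathfrak{h}_3$ is $\mathbb{R}X_3$. *)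

(* Defs.v *)
From HB Require Import structures.
From mathcomp Require Import all_boot all_order all_algebra.
From mathcomp Require Import reals ring.
Set Implicit Arguments.
Unset Strict Implicit.
Unset Printing Implicit Defensive.
Import Order.TTheory GRing.Theory Num.Theory.
Local Open Scope ring_scope.

(* The Heisenberg Lie algebra, in coordinates with respect to the basis
   (X1, X2, X3). [heis_mxE] and [heis_mx_bracket] identify it with the strictly
   upper triangular 3 x 3 matrices under the commutator, the Lie algebra of the
   group of real upper triangular unipotent matrices. *)
Notation h3 R := 'rV[R]_3.

Section Heisenberg.
Variable R : realType.
Implicit Types u v x y z : h3 R.

Definition X1 : h3 R := delta_mx 0 0.
Definition X2 : h3 R := delta_mx 0 1.
Definition X3 : h3 R := delta_mx 0 2.

Definition omega1 u : R := u 0 0.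
Definition omega2 u : R := u 0 1.
Definition omega3 u : R := u 0 2.

Definition bracket u v : h3 R :=
  (omega1 u * omega2 v - omega2 u * omega1 v) *: X3.

Definition heis_mx u : 'M[R]_3 :=
  omega1 u *: delta_mx 0 1 + omega2 u *: delta_mx 1 2
  + omega3 u *: delta_mx 0 2.

Definition central z : Prop := forall y, bracket z y = 0.

Definition automorphism (f : 'End(h3 R)) : Prop :=
  lker f = 0%VS /\ forall x y, f (bracket x y) = bracket (f x) (f y).

End Heisenberg.
Arguments X1 {R}.
Arguments X2 {R}.
Arguments X3 {R}.

(* Z_2^2, written additively: its unit is 0. *)
Notation Z22 := ('Z_2 * 'Z_2)%type.

Section Symmetric.
Variable R : realType.

(* A subgroup of Aut(h3) isomorphic to Z_2^2 is given by an embedding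
   rho : Z_2^2 -> Aut(h3). *)
Definition Z22_subgroup (rho : Z22 -> 'End(h3 R)) : Prop :=
  [/\ forall a, automorphism (rho a),
      forall a b, rho (a + b) = (rho a \o rho b)%VF
    & injective rho].

(* The standard pairing identifies Z_2^2 with its group of characters
   Z_2^2 -> {1, -1}; gamma corresponds to the character [character gamma]. *)
Definition character (gamma a : Z22) : R :=
  (-1) ^+ (gamma.1 * a.1 + gamma.2 * a.2)%N.

Definition component (rho : Z22 -> 'End(h3 R)) (gamma : Z22) :
    {vspace h3 R} :=
  (\bigcap_(a : Z22) passmx.leigenspace (rho a) (character gamma a))%VS.

Definition Z22_symmetric_structure (rho : Z22 -> 'End(h3 R)) : Prop :=
  Z22_subgroup rho /\ component rho 0 = 0%VS.

(* Left-invariant pseudo-Riemannian metrics on the Heisenberg group are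
   represented by symmetric bilinear forms B on h3. *)
Implicit Types (B : {symmetric h3 R}) (U V : {vspace h3 R}).

Definition orthogonal_spaces B U V : Prop :=
  forall x y, x \in U -> y \in V -> B x y = 0.

Definition nondegenerate_on B V : Prop :=
  forall x, x \in V -> (forall y, y \in V -> B x y = 0) -> x = 0.

(* In a suitable basis of V, the quadratic form of B is a sum of p squares
   minus a sum of q squares; in particular B is non-degenerate on V. *)
Definition has_signature B V (p q : nat) : Prop :=
  exists e : (p + q).-tuple (h3 R),
    basis_of V e /\
    forall i j : 'I_(p + q),
      B (tnth e i) (tnth e j) =
        if i == j then (if (i < p)%N then 1 else -1) else 0.

Definition Lorentzian B : Prop := has_signature B fullv 2 1.

Definition all_components_nondegenerate (rho : Z22 -> 'End(h3 R)) B : Prop :=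
  (forall gamma, gamma != 0 -> nondegenerate_on B (component rho gamma)) /\
  (forall gamma delta, gamma != 0 -> delta != 0 -> gamma != delta ->
     orthogonal_spaces B (component rho gamma) (component rho delta)).

(* Nothing is required of the pairing between the degenerate component and the
   others beyond the existence of lambda1. *)
Definition one_component_degenerate (rho : Z22 -> 'End(h3 R)) B : Prop :=
  exists lambda0 : Z22,
    [/\ lambda0 != 0,
        ~ nondegenerate_on B (component rho lambda0),
        forall gamma, gamma != 0 -> gamma != lambda0 ->
          nondegenerate_on B (component rho gamma),
        forall gamma delta, gamma != 0 -> delta != 0 ->
          gamma != lambda0 -> delta != lambda0 -> gamma != delta ->
          orthogonal_spaces B (component rho gamma) (component rho delta)
      & exists lambda1 : Z22,
          [/\ lambda1 != 0, lambda1 != lambda0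
            & has_signature B (component rho lambda0 + component rho lambda1)%VS
                1 1]].

Definition Z22_symmetric_Lorentzian (rho : Z22 -> 'End(h3 R)) B : Prop :=
  [/\ Z22_symmetric_structure rho, Lorentzian B
    & all_components_nondegenerate rho B \/ one_component_degenerate rho B].

End Symmetric.

Section HeisenbergFacts.
Variable R : realType.
Implicit Types u v z : h3 R.

Lemma bracketX : [/\ bracket X1 X2 = X3 :> h3 R, bracket X1 X3 = 0 :> h3 R
  & bracket X2 X3 = 0 :> h3 R].
Proof.
by split; rewrite /bracket /omega1 /omega2 !mxE /= ?mulr0 ?mul0r ?mulr1
  ?subr0 ?subrr ?scale1r ?scale0r.
Qed.

Lemma h3_decomp u : u = omega1 u *: X1 + omega2 u *: X2 + omega3 u *: X3.
Proof.
apply/rowP => i; rewrite !mxE /omega1 /omega2 /omega3.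
case: i => [[|[|[|//]]] hi]; rewrite /= ?mulr1 ?mulr0 ?addr0 ?add0r;
  by congr (u _ _); apply: val_inj.
Qed.

Lemma heis_mxE u (i j : 'I_3) : heis_mx u i j =
  if (i < j)%N then
    if j == 1 then omega1 u else if i == 1 then omega2 u else omega3 u
  else 0.
Proof.
rewrite !mxE.
by case: i => [[|[|[|//]]] hi]; case: j => [[|[|[|//]]] hj];
  rewrite /= ?mulr1 ?mulr0 ?addr0 ?add0r.
Qed.

Lemma heis_mx_bracket u v : heis_mx (bracket u v) =
  heis_mx u *m heis_mx v - heis_mx v *m heis_mx u.
Proof.
apply/matrixP => i j; rewrite heis_mxE !mxE !big_ord_recr !big_ord0 /=.
rewrite !heis_mxE /bracket /omega1 /omega2 /omega3 !mxE.
case: i => [[|[|[|//]]] hi]; case: j => [[|[|[|//]]] hj];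
  by rewrite /=; ring.
Qed.

Lemma centralP z : central z <-> z \in <[X3]>%VS.
Proof.
split=> [cz | /vlineP[k ->] y]; last first.
  by rewrite /bracket /omega1 /omega2 !mxE /= !mulr0 !mul0r subrr scale0r.
apply/vlineP; exists (omega3 z).
have := congr1 (@omega3 R) (cz X2); have := congr1 (@omega3 R) (cz X1).
rewrite /bracket /omega3 /omega1 /omega2 !mxE /=.
rewrite !mulr1 !mulr0 sub0r subr0 => /eqP; rewrite oppr_eq0 => /eqP z1 z0.
by rewrite {1}(h3_decomp z) /omega1 /omega2 z0 z1 !scale0r !add0r.
Qed.

End HeisenbergFacts.

Section GradingFacts.
Variable R : realType.
Implicit Types (gamma delta a b : Z22) (x y : h3 R).

Lemma Z2P (i : 'Z_2) : i = 0 \/ i = 1.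
Proof.
by case: i => [[|[|//]] hi]; [left | right]; apply: val_inj.
Qed.

Lemma characterE gamma a : character R gamma a =
  (-1) ^+ ((odd gamma.1 && odd a.1) (+) (odd gamma.2 && odd a.2)).
Proof. by rewrite /character -signr_odd oddD !oddM. Qed.

Lemma characterD gamma a b :
  character R gamma (a + b) = character R gamma a * character R gamma b.
Proof.
rewrite !characterE -signr_addb; congr ((-1) ^+ nat_of_bool _).
case: gamma a b => g1 g2 [a1 a2] [b1 b2] /=.
by case: (Z2P g1) => ->; case: (Z2P g2) => ->; case: (Z2P a1) => ->;
  case: (Z2P a2) => ->; case: (Z2P b1) => ->; case: (Z2P b2) => ->.
Qed.

Lemma characterC gamma a : character R gamma a = character R a gamma.
Proof. by rewrite /character ![(gamma.1 * _)%N]mulnC ![(gamma.2 * _)%N]mulnC. Qed.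

Lemma characterDl gamma delta a : character R (gamma + delta) a =
  character R gamma a * character R delta a.
Proof. by rewrite characterC characterD !(characterC a). Qed.

Lemma sum_character gamma :
  \sum_a character R gamma a = if gamma == 0 then 4 else 0.
Proof.
transitivity (\sum_(i : 'Z_2) \sum_(j : 'Z_2) character R gamma (i, j)).
  by rewrite pair_bigA; apply: eq_bigr => -[].
rewrite !big_ord_recl !big_ord0 !characterE; case: gamma => g1 g2 /=.
by case: (Z2P g1) => ->; case: (Z2P g2) => -> /=; ring.
Qed.

Lemma character_sq gamma a : character R gamma a * character R gamma a = 1.
Proof. by rewrite /character -expr2 sqrr_sign. Qed.

Variable rho : Z22 -> 'End(h3 R).

Lemma componentP gamma x :
  reflect (forall a, rho a x = character R gamma a *: x)
          (x \in component rho gamma).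
Proof.
apply: (iffP subv_bigcapP) => [H a | H a _].
  have := H a isT; rewrite -memvE memv_ker !lfun_simp subr_eq0.
  by move/eqP.
by rewrite -memvE memv_ker !lfun_simp subr_eq0 H.
Qed.

Hypothesis rhoG : Z22_subgroup rho.

Lemma component_bracket gamma delta x y :
  x \in component rho gamma -> y \in component rho delta ->
  bracket x y \in component rho (gamma + delta).
Proof.
case: rhoG => aut _ _ /componentP hx /componentP hy; apply/componentP => a.
rewrite (aut a).2 hx hy characterDl /bracket /omega1 /omega2 !mxE.
by rewrite scalerA; congr (_ *: _); rewrite mulrBr !mulrA;
  congr (_ - _); rewrite ![_ * character R delta a]mulrAC.
Qed.

Lemma rho0 x : rho 0 x = x.
Proof.
case: rhoG => aut rhoD _; have := congr1 (fun f : 'End(h3 R) => f x) (rhoD 0 0).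
rewrite /= addr0 comp_lfunE => /eqP; rewrite -subr_eq0 -linearB -memv_ker.
by rewrite (aut 0).1 memv0 subr_eq0 => /eqP <-.
Qed.

Let proj gamma x := \sum_a character R gamma a *: rho a x.

Let proj_in gamma x : proj gamma x \in component rho gamma.
Proof.
case: rhoG => _ rhoD _; apply/componentP => b.
rewrite /proj linear_sum scaler_sumr [RHS](reindex_inj (addrI b)) /=.
apply: eq_bigr => a _; rewrite linearZ scalerA characterD mulrA.
by rewrite character_sq mul1r rhoD comp_lfunE.
Qed.

Lemma component_sum : (\sum_gamma component rho gamma)%VS = fullv.
Proof.
apply/eqP; rewrite eqEsubv subvf; apply/subvP => x _.
have -> : x = \sum_gamma 4^-1 *: proj gamma x.
  rewrite -scaler_sumr /proj exchange_big /=.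
  under eq_bigr => a _ do rewrite -scaler_suml.
  under eq_bigr => a _ do
    under eq_bigr => g _ do rewrite characterC.
  under eq_bigr => a _ do rewrite sum_character.
  rewrite (bigD1 (0 : Z22)) //= big1 ?addr0 => [|a /negbTE->];
    last by rewrite scale0r.
  by rewrite rho0 scalerA mulVf ?scale1r // pnatr_eq0.
by apply/memv_sumP; exists (fun g => 4^-1 *: proj g x) => // g _; apply: memvZ.
Qed.

Let proj_component gamma delta x : x \in component rho delta ->
  proj gamma x = if gamma == delta then 4 *: x else 0.
Proof.
move=> /componentP hx; rewrite /proj.
under eq_bigr => a _ do rewrite hx scalerA -characterDl.
rewrite -scaler_suml sum_character -[in LHS](_ : - delta = delta); last first.
  by case: delta {hx} => d1 d2; case: (Z2P d1) => ->; case: (Z2P d2) => ->;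
    congr (_, _); apply: val_inj.
by rewrite subr_eq0; case: eqP; rewrite ?scale0r.
Qed.

Lemma component_direct : directv (\sum_gamma component rho gamma).
Proof.
apply/directv_sum_independent => us us_in sum0 g _.
have : proj g (\sum_d us d) = 4 *: us g.
  transitivity (\sum_d proj g (us d)).
    rewrite /proj exchange_big; apply: eq_bigr => a _ /=.
    by rewrite linear_sum scaler_sumr.
  rewrite (bigD1 g) //= big1 ?addr0 => [|d dg].
    by rewrite (proj_component _ (us_in g isT)) eqxx.
  by rewrite (proj_component _ (us_in d isT)) eq_sym (negbTE dg).
rewrite sum0 /proj big1 => [/esym/eqP|a _]; last by rewrite linear0 scaler0.
by rewrite scaler_eq0 pnatr_eq0 => /eqP.
Qed.

End GradingFacts.

(* Main.v *)
Require Import Defs.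
From HB Require Import structures.
From mathcomp Require Import all_boot all_order all_algebra.
From mathcomp Require Import reals.
From mathcomp Require Import ring.
Set Implicit Arguments.
Unset Strict Implicit.
Unset Printing Implicit Defensive.
Import Order.TTheory GRing.Theory Num.Theory.
Local Open Scope ring_scope.

(** The key point is that the center of h3 is isotropic; once this is known the
    rest of the grading is irrelevant, because all Lorentzian forms on h3 with
    isotropic center are equivalent under Aut(h3).

    The component containing the center is exactly R X3
    ([component_center_line]): for x in it and y in another component,
    [x, y] is homogeneous of a degree different from that of X3, while being a
    multiple of X3, so it vanishes and x is central. A form that is degenerate
    on this line satisfies B(X3, X3) = 0.

    In a Lorentzian space, the orthogonal of an isotropic vector z contains a
    unit vector U, and some V has B(V, z) <> 0 ([Lorentzian_isotropic]). For
    z = X3 the vectors U and V cannot commute, since otherwise U would be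
    central, hence isotropic; so, up to replacing U by -U, one has
    B(V, [U, V]) > 0. An automorphism may send X1 and X2 to any two
    non-commuting vectors ([automorphism_of_pair]). Send X1 to U and X2 to
    V' = s V + t U + r [U, V], so that X3 goes to s [U, V]; the scalars s, t, r
    are then adjusted successively to obtain B(V', [U, V']) = 1, B(U, V') = 0
    and B(V', V') = -1 ([adapted_pair_normal_form]). This is the Gram matrix
    of omega1^2 - omega2^2 + 2 omega2 omega3, which is the required form. *)

(** * Normal form of Lorentzian metrics with isotropic center *)

Section NormalForm.
Variable R : realType.
Implicit Types (B : {symmetric h3 R}) (u v x y z U V : h3 R).

Lemma symmetric_formC B u v : B u v = B v u.
Proof. by rewrite hermC expr0 mul1r. Qed.

(* The generic bilinearity lemmas, with plain products in R as scaling. *)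
Lemma form_addl B x y z : B (x + y) z = B x z + B y z.
Proof. exact: linearDl. Qed.

Lemma form_addr B x y z : B z (x + y) = B z x + B z y.
Proof. exact: linearDr. Qed.

Lemma form_scalel B k x z : B (k *: x) z = k * B x z.
Proof. exact: linearZl_LR. Qed.

Lemma form_scaler B k x z : B z (k *: x) = k * B z x.
Proof. exact: linearZr_LR. Qed.

Lemma form_oppl B x z : B (- x) z = - B x z.
Proof. exact: linearNl. Qed.

Lemma form_oppr B x z : B z (- x) = - B z x.
Proof. exact: linearNr. Qed.

Lemma bracket_pair U V (a b c a' b' c' : R) :
  bracket (a *: U + b *: V + c *: bracket U V)
          (a' *: U + b' *: V + c' *: bracket U V) =
  (a * b' - b * a') *: bracket U V.
Proof.
rewrite /bracket [RHS]scalerA; congr (_ *: _).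
by rewrite /omega1 /omega2 !mxE /=; ring.
Qed.

(** X1 and X2 generate h3 with the single relation that their bracket is
    central, so their images determine an endomorphism, which is injective as
    soon as it does not kill the center. *)
Lemma automorphism_of_pair U V : bracket U V != 0 ->
  exists phi : 'End(h3 R), automorphism phi /\
    forall u, phi u = omega1 u *: U + omega2 u *: V + omega3 u *: bracket U V.
Proof.
set f : h3 R -> h3 R := fun u =>
  omega1 u *: U + omega2 u *: V + omega3 u *: bracket U V.
move=> W0; have flin : linear f.
  by move=> k x y; apply/rowP => i;
    rewrite /f /omega1 /omega2 /omega3 !mxE; ring.
pose fL : {linear h3 R -> h3 R} :=
  HB.pack f (GRing.isLinear.Build R (h3 R) (h3 R) _ f flin).
have fE u : linfun fL u = f u by rewrite lfunE.
exists (linfun fL); split => //; split; last first.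
  move=> x y; rewrite !fE /f bracket_pair.
  by rewrite {2 3 4}/bracket /omega1 /omega2 /omega3 !mxE /= !mulr0 !scale0r
    !add0r mulr1.
apply/eqP; rewrite -subv0; apply/subvP => u; rewrite memv_ker fE memv0 => /eqP.
rewrite /f => fu.
have co (c d : R) : omega1 u * d - omega2 u * c = 0.
  have := bracket_pair U V (omega1 u) (omega2 u) (omega3 u) c d 0.
  rewrite fu {1}/bracket {1 2}/omega1 {1 2}/omega2 !mxE !mul0r subrr scale0r.
  by move/esym/eqP; rewrite scaler_eq0 (negbTE W0) orbF => /eqP.
have u1 : omega1 u = 0 by have := co 0 1; rewrite mulr1 mulr0 subr0.
have u2 : omega2 u = 0.
  by have /eqP := co 1 0; rewrite mulr1 mulr0 sub0r oppr_eq0 => /eqP.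
move: fu; rewrite u1 u2 !scale0r !add0r => /eqP.
rewrite scaler_eq0 (negbTE W0) orbF => /eqP u3.
by rewrite (h3_decomp u) u1 u2 u3 !scale0r !addr0.
Qed.

(** Scaling V multiplies B(V, [U, V]) by a positive square, so its sign has to
    be assumed; its value can then be normalized to 1. *)
Lemma adapted_pair_normal_form B U V :
  B X3 X3 = 0 -> B U X3 = 0 -> B U U = 1 -> 0 < B V (bracket U V) ->
  exists phi : 'End(h3 R),
    automorphism phi /\
    forall u : h3 R,
      B (phi u) (phi u) =
        omega1 u ^+ 2 + omega3 u ^+ 2 - (omega2 u - omega3 u) ^+ 2.
Proof.
move=> B33 BU3 BUU.
(* W is kept abstract, as [U, V] is by definition a multiple of X3, on which
   scalar extraction would act. *)
have [W WE] : exists W, W = bracket U V by exists (bracket U V).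
rewrite -WE => q_gt0.
have BUW : B U W = 0 by rewrite WE form_scaler BU3 mulr0.
have BWW : B W W = 0 by rewrite WE form_scaler form_scalel B33 !mulr0.
set q := B V W in q_gt0; pose m := B U V; pose n := B V V.
pose s := (Num.sqrt q)^-1.
have sq : s ^+ 2 * q = 1.
  by rewrite exprVn sqr_sqrtr ?ltW // mulVf // gt_eqF.
pose r := - (s / 2) * (1 + s ^+ 2 * (n - m ^+ 2)).
have [V' V'E] : exists V', V' = - (s * m) *: U + s *: V + r *: W.
  by eexists.
have UV' : bracket U V' = s *: W.
  have := bracket_pair U V 1 0 0 (- (s * m)) s r.
  by rewrite -WE -V'E scale1r !scale0r !addr0 mul1r mul0r subr0.
have BUV' : B U V' = 0.
  by rewrite V'E !form_addr !form_scaler BUU BUW -/m; ring.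
have BV'W : B V' W = s * q.
  by rewrite V'E !form_addl !form_scalel BUW BWW -/q; ring.
have BV'V' : B V' V' = -1.
  rewrite {1}V'E !form_addl !form_scalel BUV' (symmetric_formC _ W) BV'W.
  rewrite V'E !form_addr !form_scaler (symmetric_formC _ V U) -/m -/n -/q.
  transitivity (s ^+ 2 * (n - m ^+ 2)
                - s ^+ 2 * q * (1 + s ^+ 2 * (n - m ^+ 2))).
    by rewrite /r; field.
  by rewrite sq; ring.
have W0 : bracket U V' != 0.
  rewrite UV'; apply/eqP => sW0.
  have /eqP := form_scaler B s W V'; rewrite sW0 linear0r BV'W mulrA -expr2 sq.
  by rewrite eq_sym oner_eq0.
have [phi [aut phiE]] := automorphism_of_pair W0.
exists phi; split=> // u; rewrite phiE UV'.
rewrite !form_addl !form_scalel !form_addr !form_scaler.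
rewrite (symmetric_formC _ V' U) !(symmetric_formC _ W) BUW BWW BUU BUV' BV'V'.
rewrite BV'W; transitivity (omega1 u ^+ 2 - omega2 u ^+ 2
                            + 2 * omega2 u * omega3 u * (s ^+ 2 * q)).
  by ring.
by rewrite sq; ring.
Qed.

(** In an orthonormal basis with z = a e0 + b e1 + c e2, isotropy reads
    a^2 + b^2 = c^2; the rotation (a e1 - b e0) / c of the spacelike part of z
    is then a unit vector orthogonal to z. *)
Lemma Lorentzian_isotropic B z : Lorentzian B -> z != 0 -> B z z = 0 ->
  exists U V, [/\ B U U = 1, B U z = 0 & B V z != 0].
Proof.
case=> e [be Be] z0.
pose e0 := tnth e 0; pose e1 := tnth e 1; pose e2 := tnth e 2.
have B00 : B e0 e0 = 1 by rewrite Be.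
have B11 : B e1 e1 = 1 by rewrite Be.
have B22 : B e2 e2 = -1 by rewrite Be.
have B01 : B e0 e1 = 0 by rewrite Be.
have B10 : B e1 e0 = 0 by rewrite Be.
have B02 : B e0 e2 = 0 by rewrite Be.
have B20 : B e2 e0 = 0 by rewrite Be.
have B12 : B e1 e2 = 0 by rewrite Be.
have B21 : B e2 e1 = 0 by rewrite Be.
have [a [b [c zE]]] : exists a b c, z = a *: e0 + b *: e1 + c *: e2.
  exists (coord e 0 z), (coord e 1 z), (coord e 2 z).
  rewrite [LHS](coord_basis be (memvf z)) !big_ord_recl big_ord0 addr0 addrA.
  rewrite /e0 /e1 /e2 !(tnth_nth 0).
  by congr (_ *: _ + _ *: _ + _ *: _); congr (coord e _ z); apply: val_inj.
have Bzz : B z z = a ^+ 2 + b ^+ 2 - c ^+ 2.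
  rewrite zE !form_addl !form_scalel /= !form_addr !form_scaler /=.
  by rewrite B00 B11 B22 B01 B10 B02 B20 B12 B21; ring.
rewrite Bzz => /eqP; rewrite subr_eq0 => /eqP abc.
have c0 : c != 0.
  apply: contra_neq z0 => c0; move: abc; rewrite c0 expr0n /= => /eqP.
  rewrite paddr_eq0 ?sqr_ge0 // !expf_eq0 /= => /andP[/eqP a0 /eqP b0].
  by rewrite zE a0 b0 c0 !scale0r !addr0.
exists ((a / c) *: e1 - (b / c) *: e0), e2; rewrite zE; split.
- rewrite form_addl form_oppl !form_scalel /= !form_addr !form_oppr !form_scaler /= B00 B11 B01 B10.
  transitivity ((a ^+ 2 + b ^+ 2) / c ^+ 2); first by field.
  by rewrite abc divff // expf_eq0.
- rewrite form_addl form_oppl !form_scalel /= !form_addr !form_scaler /=.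
  by rewrite B00 B11 B01 B10 B02 B12; ring.
- rewrite !form_addr !form_scaler /= B20 B21 B22.
  by rewrite !mulr0 !add0r mulrN1 oppr_eq0.
Qed.

(** Up to automorphism there is only one Lorentzian form with isotropic
    center. *)
Lemma isotropic_center_normal_form B : Lorentzian B -> B X3 X3 = 0 ->
  exists phi : 'End(h3 R),
    automorphism phi /\
    forall u : h3 R,
      B (phi u) (phi u) =
        omega1 u ^+ 2 + omega3 u ^+ 2 - (omega2 u - omega3 u) ^+ 2.
Proof.
move=> LB B33.
have X3n0 : X3 != 0 :> h3 R.
  by apply/eqP => /rowP/(_ 2)/eqP; rewrite !mxE /= oner_eq0.
have [U [V [BUU BU3 BV3]]] := Lorentzian_isotropic LB X3n0 B33.
have BW0 : B V (bracket U V) != 0.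
  rewrite form_scaler mulf_neq0 //; apply/eqP => k0.
  (* The combination of U and V without X1-part is then a multiple of X3, and
     pairing it with X3 shows that the coefficient of V vanishes; likewise for
     the combination without X2-part. *)
  have comb (p q : R) : p * omega1 U + q * omega1 V = 0 ->
      p * omega2 U + q * omega2 V = 0 -> q = 0.
    move=> h1 h2; have wE : p *: U + q *: V =
        omega3 (p *: U + q *: V) *: X3.
      rewrite [LHS]h3_decomp {1}/omega1 {1}/omega2 !mxE.
      by rewrite -!/(omega1 _) -!/(omega2 _) h1 h2 !scale0r !add0r.
    have /eqP := congr1 (fun w => B w X3) wE.
    rewrite /= form_addl !form_scalel /= BU3 B33 !mulr0 add0r mulf_eq0.
    by rewrite (negbTE BV3) orbF => /eqP.
  have u1 : omega1 U = 0.
    apply/eqP; rewrite -oppr_eq0; apply/eqP.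
    apply: (comb (omega1 V)); first by ring.
    by rewrite -[RHS]oppr0 -[in RHS]k0; ring.
  have u2 : omega2 U = 0.
    apply/eqP; rewrite -oppr_eq0; apply/eqP.
    apply: (comb (omega2 V)); last by ring.
    by rewrite -[RHS]k0; ring.
  have := BUU; rewrite {2}(h3_decomp U) u1 u2 !scale0r !add0r form_scaler BU3 /=.
  by rewrite mulr0 => /esym/eqP; rewrite oner_eq0.
have [BW_gt0 | BW_lt0 | /eqP] := ltgtP 0 (B V (bracket U V)).
- exact: adapted_pair_normal_form BW_gt0.
- apply: (@adapted_pair_normal_form B (- U) V) => //.
  + by rewrite form_oppl BU3 oppr0.
  + by rewrite form_oppl form_oppr opprK.
  + have -> : bracket (- U) V = - bracket U V.
      rewrite /bracket -scaleNr; congr (_ *: _).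
      by rewrite /omega1 /omega2 !mxE; ring.
    by rewrite form_oppr oppr_gt0.
- by rewrite eq_sym (negbTE BW0).
Qed.

End NormalForm.

(** * The component of a grading containing the center *)

Section CenterComponent.
Variables (R : realType) (rho : Z22 -> 'End(h3 R)).

Lemma component_disjoint (gamma delta : Z22) (z : h3 R) : delta != 0 ->
  z \in component rho gamma -> z \in component rho (gamma + delta) -> z = 0.
Proof.
move=> d0 /componentP hz /componentP hz'.
have zE a : z = character R delta a *: z.
  have := hz' a; rewrite hz characterDl -scalerA.
  move/(congr1 (fun w => character R gamma a *: w)).
  by rewrite !scalerA !mulrA character_sq mul1r scale1r.
(* Averaging over the group annihilates a nontrivial character. *)
have : \sum_(a : Z22) z = 0.
  transitivity (\sum_a character R delta a *: z); first exact: eq_bigr.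
  by rewrite -scaler_suml sum_character (negbTE d0) scale0r.
rewrite sumr_const => /eqP; rewrite -scaler_nat scaler_eq0 pnatr_eq0.
by rewrite card_prod !card_ord => /eqP.
Qed.

(** A nonzero degree of y moves [x, y] out of the component of X3, although
    every bracket is a multiple of X3; degree 0 is excluded by the structure. *)
Lemma component_center_line (gamma0 : Z22) (x : h3 R) :
  Z22_symmetric_structure rho -> X3 \in component rho gamma0 ->
  x \in component rho gamma0 -> x \in <[X3]>%VS.
Proof.
case=> G H0 X3in xin; apply/centralP => y.
have : y \in (\sum_gamma component rho gamma)%VS.
  by rewrite component_sum // memvf.
case/memv_sumP => ys ysin ->.
have bracket0 g : bracket x (ys g) = 0.
  have yg := ysin g isT; have [g0 | gn0] := eqVneq g 0.
    move: yg; rewrite g0 H0 memv0 => /eqP ->.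
    by rewrite /bracket /omega1 /omega2 !mxE !mulr0 subrr scale0r.
  by apply: component_disjoint gn0 _ (component_bracket G xin yg); exact: memvZ.
transitivity (\sum_g bracket x (ys g)); last exact: big1.
rewrite /bracket -scaler_suml; congr (_ *: _).
by rewrite /omega1 /omega2 !summxE !mulr_sumr -sumrB.
Qed.

End CenterComponent.

(** * Reduction of the metric *)

Theorem proposition22 (R : realType) (rho : Z22 -> 'End(h3 R))
    (B : {symmetric h3 R}) (gamma0 : Z22)
    (hB : Z22_symmetric_Lorentzian rho B)
    (hcenter : forall z : h3 R, central z -> z \in component rho gamma0)
    (hdeg : ~ nondegenerate_on B (component rho gamma0)) :
  exists phi : 'End(h3 R),
    automorphism phi /\
    forall u : h3 R,
      B (phi u) (phi u) =
        omega1 u ^+ 2 + omega3 u ^+ 2 - (omega2 u - omega3 u) ^+ 2.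
Proof.
case: hB => S LB _.
have X3in : X3 \in component rho gamma0.
  by apply/hcenter/centralP; exact: memv_line.
apply: isotropic_center_normal_form => //.
have [//|B33] := eqVneq (B X3 X3) 0.
case: hdeg => x /(component_center_line S X3in)/vlineP[k ->] orth.
have /eqP := orth _ X3in; rewrite form_scalel mulf_eq0 (negbTE B33) orbF.
by move/eqP ->; rewrite scale0r.
Qed.
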